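(* Let $\mathbf H \in \{\mathbf Z, \mathbf N\}$. Given $\alpha \in [0,1]$ and a non-empty finite set $B \subseteq \mathbf H$, there exists $A \in \mathscr A_\infty$ such that $A+B \in \mathrm{dom}(\mu)$ and $\mu(A+B)=\alpha$ for every quasi-density $\mu$ on $\mathbf H$.
   Context: $\mathbf N=\{0,1,2,\dots\}$, $\mathbf N^+=\{1,2,\dots\}$. $A+B:=\{a+b: a\in A, b\in B\}$. For $X \subseteq \mathbf Z$ and $k,h\in\mathbf Z$, $k\cdot X+h:=\{kx+h : x\in X\}$. An arithmetic progression of $\mathbf H$ is a set $k\cdot\mathbf H+h$ with $k\in\mathbf N^+$, $h\in\mathbf H$. $\mathscr A_\infty$ is the family of subsets of $\mathbf H$ expressible as the union of a finite set and countably many arithmetic progressions of $\mathbf H$. An upper quasi-density on $\mathbf H$ is a function $\mu^\ast:\mathcal P(\mathbf H)\to\mathbf R$ such that for all $X,Y\subseteq\mathbf H$: (1) $\mu^\ast(X)\le\mu^\ast(\mathbf H)=1$; (2) $\mu^\ast(X\cup Y)\le\mu^\ast(X)+\mu^\ast(Y)$; (3) $\mu^\ast(k\cdot X+h)=\frac1k\mu^\ast(X)$ for all $k\in\mathbf N^+$, $h\in\mathbf H$ (monotonicity is not required). Its conjugate is $\mu_\ast(X):=1-\mu^\ast(\mathbf H\setminus X)$. The quasi-density induced by $\mu^\ast$ is the restriction $\mu$ of $\mu^\ast$ to $\mathrm{dom}(\mu):=\{X\subseteq\mathbf H:\mu^\ast(X)=\mu_\ast(X)\}$; a quasi-density on $\mathbf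 H$ is any function arising this way. *)

(* Defs.v *)
From mathcomp Require Import all_boot all_order all_algebra.
From mathcomp Require Import boolp classical_sets functions cardinality reals.

Set Implicit Arguments.
Unset Strict Implicit.
Unset Printing Implicit Defensive.

Import Order.TTheory GRing.Theory Num.Theory.
Local Open Scope classical_set_scope.
Local Open Scope ring_scope.

(* The ambient set H (all of Z, or N seen inside Z) is a value of type
   [set int]; subsets of H are sets of integers included in H. *)

Definition sumset (A B : set int) : set int :=
  [set a + b | a in A & b in B].

Definition dilate_shift (k h : int) (X : set int) : set int :=
  [set k * x + h | x in X].

Definition arith_progression (H P : set int) : Prop :=
  exists (k : nat) (h : int), [/\ (0 < k)%N, H h & P = dilate_shift k%:Z h H].

(* The family F of progressions is at most countable, possibly finite or
   empty. *)
Definition A_infty (H A : set int) : Prop :=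
  exists (S : set int) (F : set (set int)),
    [/\ S `<=` H, finite_set S, countable F, F `<=` arith_progression H
      & A = S `|` \bigcup_(P in F) P].

(* A function P(H) -> R is a total function on [set int] of which only the
   values at subsets of H are ever constrained or used. *)
Record upper_quasi_density (R : realType) (H : set int)
    (mus : set int -> R) : Prop := UpperQuasiDensity {
  uqd_total : mus H = 1;
  uqd_le : forall X, X `<=` H -> mus X <= mus H;
  uqd_subadd : forall X Y, X `<=` H -> Y `<=` H ->
    mus (X `|` Y) <= mus X + mus Y;
  uqd_dilate : forall X (k : nat) (h : int), X `<=` H -> (0 < k)%N -> H h ->
    mus (dilate_shift k%:Z h X) = k%:R^-1 * mus X }.

Definition conjugate (R : realType) (H : set int) (mus : set int -> R)
    (X : set int) : R :=
  1 - mus (H `\` X).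

(* Partial real-valued functions on sets of integers; [None] means
   undefined. *)
Definition pdom (R : realType) (mu : set int -> option R) : set (set int) :=
  [set X | isSome (mu X)].

Definition induced (R : realType) (H : set int) (mus : set int -> R)
    (X : set int) : option R :=
  if `[< X `<=` H /\ mus X = conjugate H mus X >] then Some (mus X) else None.

Definition quasi_density (R : realType) (H : set int)
    (mu : set int -> option R) : Prop :=
  exists mus : set int -> R, upper_quasi_density H mus /\ mu = induced H mus.

(* Main.v *)
(** Ordering the integers by the bit reversals of their residues modulo [2 ^ n]
    gives, for [j <= 2 ^ n], a chain of unions [C n j] of [j] residue classes,
    with [C n j = C n.+1 (2 * j)].  Passing from [C n j] to [C n j.+1] adds one
    class, so it raises the density of [C n j + B] by at most [#|B| / 2 ^ n].
    Let [A] be the union of all [C n j] such that [C n j + B] has density at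
    most [alpha].  At every level [n], [A] lies between consecutive [C n j] and
    [C n j.+1], whose sums with [B] have densities around [alpha].  Although
    upper quasi-densities need not be monotone, a subset of a union of [r]
    residue classes modulo [k] has upper quasi-density at most [r / k]; applied
    to [A + B] and to its complement, this pins both values down. *)

Require Import Defs.
From mathcomp Require Import all_boot all_order all_algebra.
From mathcomp Require Import boolp classical_sets functions cardinality reals.
From mathcomp Require Import zify ring lra.

Set Implicit Arguments.
Unset Strict Implicit.
Unset Printing Implicit Defensive.

Import Order.TTheory GRing.Theory Num.Theory.
Local Open Scope classical_set_scope.
Local Open Scope ring_scope.

(** * Periodic sets and counts of residue classes *)

Definition periodic (k : nat) (X : set int) : Prop :=
  forall x q : int, X x -> X (x + q * k%:Z).

(* Only meaningful for [k]-periodic [X]: the number of classes making up [X]. *)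
Definition residue_count (k : nat) (X : set int) : nat :=
  (\sum_(i < k) `[< X i%:Z >])%N.

Lemma residue_count_le (k : nat) (X Y : set int) :
  X `<=` Y -> (residue_count k X <= residue_count k Y)%N.
Proof.
move=> XY; apply: leq_sum => i _; case: asboolP => // Xi.
by rewrite asboolT //; exact: XY.
Qed.

Lemma residue_countU (k : nat) (X Y : set int) :
  (residue_count k (X `|` Y) <= residue_count k X + residue_count k Y)%N.
Proof.
rewrite /residue_count -big_split /=; apply: leq_sum => i _.
by do 3 case: asboolP => //; move=> ? ? [].
Qed.

Lemma residue_countC (k : nat) (X : set int) :
  (residue_count k (~` X) + residue_count k X = k)%N.
Proof.
rewrite /residue_count -big_split /= -[RHS]card_ord -sum1_card.
by apply: eq_bigr => i _; do 2 case: asboolP.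
Qed.

Lemma residue_countT (k : nat) : residue_count k setT = k.
Proof.
rewrite -[RHS]card_ord -sum1_card; apply: eq_bigr => i _.
by rewrite asboolT.
Qed.

Lemma residue_count0 (k : nat) : residue_count k set0 = 0%N.
Proof. by rewrite /residue_count big1 // => i _; case: asboolP. Qed.

Lemma residue_count_le1 (k : nat) (X : set int) :
  (forall x y, X x -> X y -> exists q, x = y + q * k%:Z) ->
  (residue_count k X <= 1)%N.
Proof.
move=> Xk; have [[i Xi]|noX] := pselect (exists i : 'I_k, X i%:Z); last first.
  by rewrite /residue_count big1 // => i _; case: asboolP => // ?; case: noX; exists i.
rewrite /residue_count (bigD1 i) //= big1 ?addn0 ?leq_b1 // => j ji.
case: asboolP => // Xj; case/eqP: ji; apply: val_inj => /=.
have [q eq_ji] := Xk _ _ Xj Xi.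
have := ltn_ord j; have := ltn_ord i.
have [q0|q0|q0] := ltrgtP q 0; last by lia.
- have : q * k%:Z <= - k%:Z by nia.
  by lia.
- have : k%:Z <= q * k%:Z by nia.
  by lia.
Qed.

(** The representatives below [m * k] form [m] blocks of length [k], and by periodicity each block
    contributes the same count. This lets counts at different levels be compared. *)
Lemma residue_countM (k m : nat) (X : set int) :
  periodic k X -> residue_count (m * k) X = (m * residue_count k X)%N.
Proof.
move=> Xk; rewrite /residue_count.
elim: m => [|m IH]; first by rewrite !mul0n big_ord0.
rewrite mulSnr big_split_ord /= IH mulSnr; congr (_ + _)%N.
apply: eq_bigr => i _; congr nat_of_bool; apply/asboolP/asboolP => Xi.
  have -> : i%:Z = (m * k + i)%N%:Z + (- m%:Z) * k%:Z by lia.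
  exact: Xk.
have -> : (m * k + i)%N%:Z = i%:Z + m%:Z * k%:Z by lia.
exact: Xk.
Qed.

Lemma sumset_mono (X Y B : set int) : X `<=` Y -> sumset X B `<=` sumset Y B.
Proof. by move=> XY _ [x Xx [b Bb <-]]; exists x; [exact: XY|exists b]. Qed.

Lemma periodic_sumset (k : nat) (X B : set int) :
  periodic k X -> periodic k (sumset X B).
Proof.
move=> Xk _ q [x Xx [b Bb <-]]; exists (x + q * k%:Z); first exact: Xk.
by exists b => //; ring.
Qed.

Lemma periodicC (k : nat) (X : set int) : periodic k X -> periodic k (~` X).
Proof.
move=> Xk x q nXx Xxq; apply: nXx.
by rewrite (_ : x = x + q * k%:Z + - q * k%:Z); [exact: Xk|ring].
Qed.

(** [X] lies in a single class modulo [k], so each entry of [s] translates it into a single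
    class. *)
Lemma residue_count_sumset_seq (k : nat) (X : set int) (s : seq int) :
  (forall x y, X x -> X y -> exists q, x = y + q * k%:Z) ->
  (residue_count k (sumset X [set` s]) <= size s)%N.
Proof.
move=> Xk; elim: s => [|b s IH] /=.
  rewrite (_ : sumset _ _ = set0) ?residue_count0 //.
  by apply/seteqP; split => // x [a _ [c]].
have Xb : (residue_count k [set (x + b)%R | x in X] <= 1)%N.
  apply: residue_count_le1 => _ _ [x Xx <-] [y Xy <-].
  by have [q ->] := Xk _ _ Xx Xy; exists q; ring.
rewrite -add1n; apply: leq_trans (leq_add Xb IH).
apply: leq_trans (residue_countU _ _ _); apply: residue_count_le.
move=> _ [x Xx [c /= cs <-]]; move: cs; rewrite inE => /predU1P[->|cs].
  by left; exists x.
by right; exists x => //; exists c.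
Qed.

(** * Bit reversal and the chain of unions of classes *)

(* The integer whose binary expansion is that of [x] modulo [2 ^ n] read
   backwards. *)
Fixpoint bit_reversal (n : nat) (x : int) : int :=
  if n is m.+1 then 2 * bit_reversal m x + ((x %/ (2 ^ m)%N)%Z %% 2)%Z else 0.

Lemma bit_reversal_bounds (n : nat) (x : int) :
  0 <= bit_reversal n x < (2 ^ n)%N%:Z.
Proof. by elim: n => [|n IH] //=; rewrite expnS; lia. Qed.

Lemma divz_pow2MDl (n : nat) (x q : int) :
  ((x + q * (2 ^ n)%N) %/ (2 ^ n)%N)%Z = q + (x %/ (2 ^ n)%N)%Z.
Proof. by rewrite addrC divzMDl //; have := expn_gt0 2 n; lia. Qed.

Lemma bit_reversal_periodic (n : nat) (x q : int) :
  bit_reversal n (x + q * (2 ^ n)%N%:Z) = bit_reversal n x.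
Proof.
elim: n q => [//|n IH] q /=.
have -> : x + q * (2 ^ n.+1)%N = x + (q * 2) * (2 ^ n)%N.
  by rewrite expnS PoszM; ring.
by rewrite IH divz_pow2MDl; lia.
Qed.

Lemma bit_reversal_inj (n : nat) (x y : int) :
  bit_reversal n x = bit_reversal n y -> exists q, x = y + q * (2 ^ n)%N%:Z.
Proof.
elim: n => [|n IH] /= eq_xy; first by exists (x - y); rewrite expn0; ring.
have /IH[q def_x] : bit_reversal n x = bit_reversal n y by lia.
exists (q %/ 2)%Z; move: eq_xy.
rewrite def_x divz_pow2MDl bit_reversal_periodic => eq_xy.
(* Equality of the binary digits of weight [2 ^ n] forces [q] to be even, which lifts the congruence
   to modulus [2 ^ n.+1]. *)
have {1}-> : q = (q %/ 2)%Z * 2 by lia.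
by rewrite expnS PoszM; ring.
Qed.

(** The set [C n j] of the overview. *)
Definition initial_classes (n j : nat) : set int :=
  [set x | bit_reversal n x < j%:Z].

Lemma initial_classes_periodic (n j : nat) :
  periodic (2 ^ n) (initial_classes n j).
Proof. by move=> x q; rewrite /initial_classes /= bit_reversal_periodic. Qed.

Lemma initial_classes_le (n i j : nat) :
  (i <= j)%N -> initial_classes n i `<=` initial_classes n j.
Proof. by move=> ij x; rewrite /initial_classes /=; lia. Qed.

Lemma initial_classes0 (n : nat) : initial_classes n 0 = set0.
Proof.
apply/seteqP; split => // x; rewrite /initial_classes /=.
by have := bit_reversal_bounds n x; lia.
Qed.

Lemma initial_classesT (n j : nat) :
  (2 ^ n <= j)%N -> initial_classes n j = setT.
Proof.
move=> nj; apply/seteqP; split => // x _; rewrite /initial_classes /=.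
by have := bit_reversal_bounds n x; lia.
Qed.

(** Raising the level by one appends a low digit [e] to the reversal [r], and [2 * r + e < 2 * j]
    iff [r < j]. This compatibility is the reason for the bit-reversed order. *)
Lemma initial_classes_refine (n d j : nat) :
  initial_classes (n + d) (j * 2 ^ d) = initial_classes n j.
Proof.
elim: d => [|d IH]; first by rewrite addn0 muln1.
rewrite -IH addnS expnSr; apply/seteqP.
by split => x; rewrite /initial_classes /=; lia.
Qed.

(** The elements gained have reversal exactly [j], hence fill one class by [bit_reversal_inj]. *)
Lemma sumset_initial_classesS (n j : nat) (s : seq int) :
  (residue_count (2 ^ n) (sumset (initial_classes n j.+1) [set` s])
   <= residue_count (2 ^ n) (sumset (initial_classes n j) [set` s])
      + size s)%N.
Proof.
set X := [set x | bit_reversal n x = j%:Z].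
have sX : (residue_count (2 ^ n) (sumset X [set` s]) <= size s)%N.
  apply: residue_count_sumset_seq => x y; rewrite /X /= => <- eq_xy.
  exact: bit_reversal_inj.
apply: leq_trans (leq_add (leqnn _) sX).
apply: leq_trans (residue_countU _ _ _); apply: residue_count_le.
move=> _ [x Xx [b Bb <-]].
have [lt_xj|nlt_xj] := boolP (bit_reversal n x < j%:Z).
  by left; exists x => //; exists b.
right; exists x; last by exists b.
by move: Xx nlt_xj; rewrite /initial_classes /X /=; lia.
Qed.

Lemma residue_count_refine (B : set int) (n d j : nat) :
  residue_count (2 ^ (n + d)) (sumset (initial_classes (n + d) (j * 2 ^ d)) B)
  = (2 ^ d * residue_count (2 ^ n) (sumset (initial_classes n j) B))%N.
Proof.
rewrite initial_classes_refine expnD mulnC residue_countM //.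
exact/periodic_sumset/initial_classes_periodic.
Qed.

(** * Cutting the chain at density [alpha] *)

Section Cut.
Variables (R : realType) (alpha : R) (B : set int).
Hypothesis alpha01 : 0 <= alpha <= 1.

Definition light (n j : nat) : Prop :=
  (residue_count (2 ^ n) (sumset (initial_classes n j) B))%:R
    <= alpha * (2 ^ n)%:R.

Definition cut : set int :=
  [set x | exists n j, light n j /\ initial_classes n j x].

(** At the common level [n + m] the sets of the chain are nested. A light set containing a heavy one
    would make the latter light, so every light set lies inside every heavy one. *)
Lemma cut_sub_heavy (n j : nat) : ~ light n j -> cut `<=` initial_classes n j.
Proof.
move=> heavy x [m [i [light_i xi]]].
rewrite -(initial_classes_refine n m j); move: xi.
rewrite -(initial_classes_refine m n i) addnC.
apply: initial_classes_le; rewrite leqNgt; apply/negP => /ltnW ji.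
apply: heavy; rewrite /light.
have := residue_count_le (2 ^ (n + m))
  (sumset_mono (B := B) (initial_classes_le (n := n + m) ji)).
rewrite residue_count_refine [in X in (_ <= X)%N]addnC residue_count_refine.
rewrite -(ler_nat R) !natrM => le_ji.
have pm : 0 < (2 ^ m)%:R :> R by rewrite ltr0n expn_gt0.
have pn : 0 < (2 ^ n)%:R :> R by rewrite ltr0n expn_gt0.
rewrite -(ler_pM2l pm); apply: le_trans le_ji _.
by rewrite [leRHS](_ : _ = (2 ^ n)%:R * (alpha * (2 ^ m)%:R)) ?ler_pM2l //; ring.
Qed.

Lemma cut_sandwich (n : nat) : B !=set0 ->
  exists j, [/\ light n j, initial_classes n j `<=` cut,
    cut `<=` initial_classes n j.+1 &
    alpha * (2 ^ n)%:R <=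
      (residue_count (2 ^ n) (sumset (initial_classes n j.+1) B))%:R].
Proof.
move=> [b Bb].
have sumT : sumset setT B = setT.
  by apply/seteqP; split => // x _; exists (x - b) => //; exists b => //; ring.
have countT j : (2 ^ n <= j)%N ->
    residue_count (2 ^ n) (sumset (initial_classes n j) B) = (2 ^ n)%N.
  by move=> nj; rewrite initial_classesT // sumT residue_countT.
have pn : 0 < (2 ^ n)%:R :> R by rewrite ltr0n expn_gt0.
have sub j : light n j -> initial_classes n j `<=` cut.
  by move=> lj x xj; exists n, j.
have [lightT|heavyT] := pselect (light n (2 ^ n)).
  (* At the top of the chain the index [j.+1] exceeds [2 ^ n], but the union is then still all of
     the integers; the last bound becomes [alpha <= 1]. *)
  exists (2 ^ n)%N; split => //; first exact: sub.
    by rewrite (initial_classesT (leqnSn _)).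
  by rewrite countT // ger_pMl //; case/andP: alpha01.
have light0 : light n 0.
  rewrite /light initial_classes0 (_ : sumset _ _ = set0).
    by rewrite residue_count0 mulr_ge0 // (andP alpha01).1.
  by apply/seteqP; split => // x [].
(* Without such a jump, induction from [light0] would make every index light, contradicting
   [heavyT]. *)
have [j lj heavy_j] : exists2 j, light n j & ~ light n j.+1.
  apply: contrapT => nojump; apply: heavyT; elim: (2 ^ n)%N => // j IH.
  by apply: contrapT => hj; apply: nojump; exists j.
exists j; split => //; [exact: sub|exact: cut_sub_heavy|].
by move/negP: heavy_j; rewrite -ltNge => /ltW.
Qed.

End Cut.

(** * Upper bounds replacing monotonicity *)

Section QuasiDensity.
Variables (R : realType) (H : set int) (mus : set int -> R).
Hypothesis hH : H = [set: int] \/ H = range Posz.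
Hypothesis hmus : upper_quasi_density H mus.

Lemma ambient_ge0 (x : int) : 0 <= x -> H x.
Proof. by case: hH => -> // x0; exists `|x|%N => //; lia. Qed.

Lemma ambient_divz (x : int) (k : nat) : H x -> H (x %/ k%:Z)%Z.
Proof.
case: hH => -> // -[n _ <-]; exists (n %/ k)%N => //.
by rewrite divz_nat.
Qed.

Lemma ambientD (x y : int) : H x -> H y -> H (x + y).
Proof. by case: hH => -> // -[n _ <-] [m _ <-]; exists (n + m)%N. Qed.

Lemma ambientMn (x : int) (k : nat) : H x -> H (k%:Z * x).
Proof. by case: hH => -> // -[n _ <-]; exists (k * n)%N. Qed.

(* [X = X `|` X] and subadditivity. *)
Lemma mus_ge0 (X : set int) : X `<=` H -> 0 <= mus X.
Proof.
by move=> XH; have := uqd_subadd hmus XH XH; rewrite setUid; lra.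
Qed.

Lemma mus_set0 : mus set0 = 0.
Proof.
have := uqd_dilate hmus (X := set0) (k := 2) (h := 0) (@sub0set _ _) isT
  (ambient_ge0 (lexx _)).
rewrite (_ : dilate_shift _ _ _ = set0); first lra.
by apply/seteqP; split => // x [].
Qed.

(** The singleton of 0 is its own dilate by 2, so its value equals half of itself; every other
    singleton is a shift of it. *)
Lemma mus_set1 (x : int) : H x -> mus [set x] = 0.
Proof.
move=> Hx; have H0 : H 0 by exact: ambient_ge0.
have sH : [set 0] `<=` H by move=> _ ->; exact: ambient_ge0.
have := uqd_dilate hmus (k := 2) sH isT H0.
have := uqd_dilate hmus (k := 1) sH isT Hx.
rewrite /dilate_shift !image_set1 !mulr0 !add0r => ->.
lra.
Qed.

Lemma mus_finite (X : set int) : X `<=` H -> finite_set X -> mus X = 0.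
Proof.
move=> XH /finite_seqP[s eX]; rewrite {}eX in XH *.
elim: s XH => [|x s IH] XH; first by rewrite set_nil mus_set0.
have eXs : [set` x :: s] = [set x] `|` [set` s].
  apply/seteqP; split => y /=; rewrite inE.
    by move=> /predU1P[->|]; [left|right].
  by move=> [->|ys]; apply/predU1P; [left|right].
rewrite eXs in XH |- *.
have xH : [set x] `<=` H by move=> y yx; apply: XH; left.
have sH : [set` s] `<=` H by move=> y ys; apply: XH; right.
apply/eqP; rewrite eq_le mus_ge0 // andbT.
by have := uqd_subadd hmus xH sH; rewrite mus_set1 ?IH ?addr0 //; exact: xH.
Qed.

(* Monotonicity being unavailable, [X] is cut along the residue classes modulo
   [k]; each piece is a dilated shift of a subset of [H]. *)
Lemma mus_le_residue_count (k : nat) (X Z : set int) :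
  (0 < k)%N -> X `<=` H -> X `<=` Z -> periodic k Z ->
  mus X * k%:R <= (residue_count k Z)%:R.
Proof.
move=> k0 XH XZ Zk; have k0R : 0 < k%:R :> R by rewrite ltr0n.
pose piece r := [set x | X x /\ (x %% k%:Z)%Z = r%:Z].
have piece_le r : (r < k)%N -> mus (piece r) * k%:R <= `[< Z r%:Z >]%:R.
  move=> rk; case: asboolP => [_|nZr]; last first.
    rewrite (_ : piece r = set0) ?mus_set0 ?mul0r //.
    apply/seteqP; split => // x [Xx xr]; apply: nZr.
    have -> : r%:Z = x + - (x %/ k%:Z)%Z * k%:Z.
      by rewrite -xr {2}(divz_eq x k%:Z); ring.
    exact/Zk/XZ.
  (* [Q] collects the quotients of the piece. Bounding [mus Q] by [mus H = 1] bounds the piece by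
     [1 / k]. *)
  pose Q := [set q | H q /\ X (k%:Z * q + r%:Z)].
  have QH : Q `<=` H by move=> q [].
  have -> : piece r = dilate_shift k%:Z r%:Z Q.
    apply/seteqP; split => [x [Xx xr]|_ [q [Hq Xq] <-]].
      have ex : k%:Z * (x %/ k%:Z)%Z + r%:Z = x.
        by rewrite {2}(divz_eq x k%:Z) xr mulrC.
      exists (x %/ k%:Z)%Z => //; split; last by rewrite ex.
      exact/ambient_divz/XH.
    split => //; rewrite mulrC modzMDl modz_small //.
  rewrite (uqd_dilate hmus) //; last exact: ambient_ge0.
  rewrite mulrAC mulVf ?gt_eqF // mul1r -(uqd_total hmus).
  exact: uqd_le.
(* The pieces are reassembled one residue at a time by subadditivity. *)
have pref m : (m <= k)%N -> let Y := [set x | X x /\ (x %% k%:Z)%Z < m%:Z] in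
    mus Y * k%:R <= (\sum_(i < m) `[< Z i%:Z >])%N%:R.
  elim: m => [_|m IH mk] /=.
    rewrite big_ord0 (_ : [set _ | _] = set0) ?mus_set0 ?mul0r //.
    by apply/seteqP; split => // x [Xx]; have := modz_ge0 x (d := k%:Z); lia.
  rewrite big_ord_recr /= natrD.
  have -> : [set x | X x /\ (x %% k%:Z)%Z < m.+1%:Z] =
      [set x | X x /\ (x %% k%:Z)%Z < m%:Z] `|` piece m.
    apply/seteqP; split => [x [Xx xm]|x [[Xx xm]|[Xx xm]]]; last first.
    - by split => //; lia.
    - by split => //; lia.
    - have [lt_xm|nlt_xm] := boolP ((x %% k%:Z)%Z < m%:Z); first by left.
      by right; split => //; lia.
  apply: le_trans (lerD (IH (ltnW mk)) (piece_le m mk)).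
  rewrite -mulrDl ler_pM2r //.
  by apply: (uqd_subadd hmus) => x [/XH].
have := pref k (leqnn k); rewrite /residue_count /=.
rewrite (_ : [set _ | _] = X) //.
apply/seteqP; split => [x []//|x Xx]; split => //.
exact: ltz_pmod.
Qed.

(** The part of [X] in [E] is finite, hence null, and subadditivity discards it. *)
Lemma mus_le_residue_count_finite (k : nat) (X Z E : set int) :
  (0 < k)%N -> X `<=` H -> X `<=` Z `|` E -> finite_set E -> periodic k Z ->
  mus X * k%:R <= (residue_count k Z)%:R.
Proof.
move=> k0 XH XZE Efin Zk.
have XZH : X `&` Z `<=` H by move=> x [/XH].
have XEH : X `&` E `<=` H by move=> x [/XH].
have := uqd_subadd hmus XZH XEH.
rewrite -setIUr (setIidl XZE) (@mus_finite (X `&` E)) //; last first.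
  exact: finite_setIr.
rewrite addr0 => leX; apply: le_trans (_ : mus (X `&` Z) * k%:R <= _).
  by rewrite ler_wpM2r.
by apply: mus_le_residue_count.
Qed.

(* When [H] is the set of naturals, [(H `&` C) + B] may differ from
   [H `&` (C + B)], but only at such points. *)
Lemma finite_escape (B : set int) : finite_set B ->
  finite_set [set x | H x /\ exists2 b, B b & ~ H (x - b)].
Proof.
move=> Bfin; apply: (@sub_finite_set _ _
  (\bigcup_(b in B) [set x | H x /\ ~ H (x - b)])).
  by move=> x [Hx [b Bb nH]]; exists b.
apply: bigcup_finite => // b Bb.
apply: (@sub_finite_set _ _ (Posz @` `I_(`|b|%N))); last first.
  exact/finite_image/finite_II.
move=> x [Hx nH]; have xb : x - b < 0.
  by rewrite ltNge; apply/negP => /ambient_ge0.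
case: hH => eH; first by case: nH; rewrite eH.
by move: Hx xb; rewrite eH => -[n _ <-] xb; exists n => //=; lia.
Qed.

End QuasiDensity.

(** * Passage to the limit and conclusion *)

Lemma le0_of_pow2_bound (R : realType) (x : R) (c : nat) :
  (forall n, x * (2 ^ n)%:R <= c%:R) -> x <= 0.
Proof.
move=> xc; rewrite leNgt; apply/negP => x0.
have := archi_boundP (divr_ge0 (ler0n R c) (ltW x0)).
(* This [n] exceeds [c / x], and [2 ^ n] exceeds [n]. *)
set n := Num.bound _; rewrite ltr_pdivrMr // => lt_cn.
have := xc n; rewrite leNgt => /negP; apply.
by rewrite (lt_trans lt_cn) // mulrC ltr_pM2l // ltr_nat ltn_expl.
Qed.

(** Each [x] of the cut lies in a light [2 ^ n]-periodic set, so [2 ^ n * H + x] stays in the cut.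
    The family of all progressions inside is countable, being indexed by pairs [(k, h)]. *)
Lemma cut_A_infty (R : realType) (alpha : R) (B H : set int) :
  H = [set: int] \/ H = range Posz -> A_infty H (H `&` cut alpha B).
Proof.
move=> hH.
exists set0, [set P | arith_progression H P /\ P `<=` H `&` cut alpha B].
split; [exact: sub0set|exact: finite_set0|..].
- apply: (@sub_countable _ _ _
    (range (fun kh : nat * int => dilate_shift kh.1%:Z kh.2 H))); last first.
    apply: sub_countable (card_image_le _ _) _; exact: countableP.
  apply: subset_card_le => _ [[k [h [_ _ ->]]] _].
  by exists (k, h).
- by move=> P [].
rewrite set0U; apply/seteqP; split => [x [Hx [n [j [lj xj]]]]|x [P [_ PA] Px]].
  exists (dilate_shift (2 ^ n)%N%:Z x H); last first.
    by exists 0; [exact: ambient_ge0|rewrite mulr0 add0r].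
  split; first by exists (2 ^ n)%N, x; rewrite expn_gt0.
  move=> _ [q Hq <-]; split; first exact/(ambientD hH)/Hx/(ambientMn hH).
  exists n, j; split => //; rewrite addrC mulrC.
  exact: initial_classes_periodic.
exact: PA.
Qed.

Theorem theorem3p2 (R : realType) (H : set int)
    (hH : H = [set: int] \/ H = range Posz)
    (alpha : R) (halpha : 0 <= alpha <= 1)
    (B : set int) (hBH : B `<=` H) (hBfin : finite_set B) (hB0 : B !=set0) :
  exists A : set int, A_infty H A /\
    forall mu : set int -> option R, quasi_density H mu ->
      pdom mu (sumset A B) /\ mu (sumset A B) = Some alpha.
Proof.
exists (H `&` cut alpha B); split; first exact: cut_A_infty.
move=> _ [mus [hmus ->]]; set X := sumset _ _.
have XH : X `<=` H.
  by move=> _ [a [Ha _] [b Bb <-]]; exact/(ambientD hH)/hBH.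
have HXH : H `\` X `<=` H by move=> x [].
have [s eB] : exists s : seq int, B = [set` s] by exact/finite_seqP.
have pn n : (0 < 2 ^ n)%N by rewrite expn_gt0.
(* The count for [j.+1] is at most that for the light index [j] plus [size s], an error that
   vanishes relative to [2 ^ n]. *)
have le_alpha : mus X - alpha <= 0.
  apply: (@le0_of_pow2_bound _ _ (size s)) => n.
  have [j [lj _ sub_cut _]] := cut_sandwich halpha n hB0.
  have XZ : X `<=` sumset (initial_classes n j.+1) B.
    by apply: sumset_mono => x [_ /sub_cut].
  have := mus_le_residue_count hH hmus (pn n) XH XZ
    (periodic_sumset (@initial_classes_periodic _ _)).
  have := sumset_initial_classesS n j s; rewrite -eB -(ler_nat R) natrD.
  by move: lj; rewrite /light; lra.
have le_compl : mus (H `\` X) - (1 - alpha) <= 0.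
  apply: (@le0_of_pow2_bound _ _ (size s)) => n.
  have [j [_ sub_cut _ gej]] := cut_sandwich halpha n hB0.
  set Y := sumset (initial_classes n j) B.
  (* A point [a + b] of [Y] can miss [X] only because [a] falls outside [H]; such points form a
     finite set. *)
  have XY : H `\` X `<=`
      ~` Y `|` [set x | H x /\ exists2 b, B b & ~ H (x - b)].
    move=> x [Hx nXx]; have [[a Ca [b Bb eab]]|] := pselect (Y x); last by left.
    right; split => //; exists b => // Hxb; apply: nXx; exists a.
      by split; [rewrite -eab addrK in Hxb|exact: sub_cut].
    by exists b.
  have := mus_le_residue_count_finite hH hmus (pn n) HXH XY
    (finite_escape hH hBfin)
    (periodicC (periodic_sumset (@initial_classes_periodic _ _))).
  have := congr1 (fun m => m%:R : R) (residue_countC (2 ^ n) Y).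
  have := sumset_initial_classesS n j s; rewrite -eB -(ler_nat R) !natrD.
  by move: gej; rewrite -/Y; lra.
(* Subadditivity gives [1 <= mus X + mus (H \ X)], while the two bounds sum to 1, so both are
   equalities. *)
have := uqd_subadd hmus XH HXH; rewrite setDUK // (uqd_total hmus) => total.
have eX : mus X = alpha by lra.
have dX : X `<=` H /\ mus X = conjugate H mus X.
  by split => //; rewrite /conjugate; lra.
by rewrite /pdom /= /induced asboolT // eX.
Qed.
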